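(* In the Bernoulli model, for a text $T$ let $\mathrm{occ}(T)$ be the number of occurrences of $w$ in $T$, $\mathrm{cl}(T)$ the number of clumps of $w$ in $T$, and $\mathrm{cov}(T)$ the number of positions of $T$ covered by at least one occurrence of $w$. Define $$\mathfrak{K}(z,x,t)=\frac{x\,\pi_w (zt)^{\ell}}{1-x\,K(zt)}\qquad\text{and}\qquad F(z,y)=N(z)+\frac{R(z)}{\pi_w z^{\ell}}\;y\;\frac{1}{1-\dfrac{M(z)-K(z)}{\pi_w z^{\ell}}\,y}\;U(z).$$ Then, as formal power series, $$G(z,x,t,u):=\sum_{T\in\mathcal{A}^*}\mathbf{P}(T)\,z^{|T|}x^{\mathrm{occ}(T)}t^{\mathrm{cov}(T)}u^{\mathrm{cl}(T)}=F\big(z,\,u\,\mathfrak{K}(z,x,t)\big).$$ Moreover $\mathfrak{K}(z,x,t)=\sum_{\mathfrak{c}}\mathbf{P}(\mathfrak{c})z^{|\mathfrak{c}|}t^{|\mathfrak{c}|}x^{\mathrm{occ}(\mathfrak{c})}$, the sum being over all words of $w\mathcal{C}^*$ (the possible clump words).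
   Context: Let $\mathcal{A}$ be a finite alphabet with $|\mathcal{A}|\ge2$ and $w\in\mathcal{A}^*$ a fixed word of length $\ell=|w|\ge 2$. Bernoulli model: each letter $a\in\mathcal{A}$ has probability $p_a>0$, $\sum_a p_a=1$, and $\mathbf{P}(a_1\cdots a_n)=\prod_i p_{a_i}$. For a language $L$ its generating function is $L(z)=\sum_{x\in L}\mathbf{P}(x)z^{|x|}$; $\pi_w=\mathbf{P}(w)$. An occurrence of $w$ in $T$ is a position interval $[i,i+\ell-1]$ with $T_i\cdots T_{i+\ell-1}=w$; two occurrences overlap if their intervals share a position; clumps are equivalence classes of occurrences under the transitive closure of overlapping. Autocorrelation set: $\mathcal{C}=\{\epsilon\}\cup\{e\in\mathcal{A}^+: |e|<\ell,\ \exists e'\in\mathcal{A}^+,\ we=e'w\}$, $\mathcal{C}_\circ=\mathcal{C}\setminus\{\epsilon\}$, $\mathcal{K}=\mathcal{C}_\circ\setminus\mathcal{C}_\circ\mathcal{A}^+$, with generating functions $C(z)$, $K(z)$. Languages: $\mathcal{R}=\{r\in\mathcal{A}^*w: \text{no } r=xwy,\ |y|>0\}$; $\mathcal{M}=\{m\in\mathcal{A}^+: wm\in\mathcal{A}^*w,\ \text{no } wm=xwy,\ |x|>0,|y|>0\}$; $\mathcal{U}=\{u\in\mathcal{A}^*: \text{no } wu=xwy,\ |x|>0\}$; $\mathcal{N}=\{n: w\text{ not a factor of }n\}$, with generating functions $R(z),M(z),U(z),N(z)$. It is known (Régnier–Szpankowski) that with $D(z)=\pi_w z^{\ell}+(1-z)C(z)$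 one has $R(z)=\pi_w z^{\ell}/D(z)$, $M(z)=1+(z-1)/D(z)$, $U(z)=1/D(z)$, $N(z)=C(z)/D(z)$. *)

(* Defs.v *)
(* Multivariate formal power series in (z,x,t,u) are
   represented by their coefficient functions nat -> nat -> nat -> nat -> R
   (exponents of z, x, t, u in that order). *)
From HB Require Import structures.
From mathcomp Require Import all_boot all_order all_algebra.
From Stdlib Require Import ClassicalEpsilon.
Set Implicit Arguments. Unset Strict Implicit. Unset Printing Implicit Defensive.
Import Order.TTheory GRing.Theory Num.Theory.
Local Open Scope ring_scope.

Definition pb (P : Prop) : bool :=
  if excluded_middle_informative P then true else false.

Section Series.
Variable R : comNzRingType.

Definition fps := nat -> nat -> nat -> nat -> R.

Definition fadd (f g : fps) : fps := fun n a b c => f n a b c + g n a b c.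
Definition fsub (f g : fps) : fps := fun n a b c => f n a b c - g n a b c.
Definition fscale (r : R) (f : fps) : fps := fun n a b c => r * f n a b c.
Definition fmon (r : R) (i j k l : nat) : fps :=
  fun n a b c => if [&& n == i, a == j, b == k & c == l] then r else 0.
Definition fone : fps := fmon 1 0 0 0 0.
Definition fmul (f g : fps) : fps := fun n a b c =>
  \sum_(i < n.+1) \sum_(j < a.+1) \sum_(k < b.+1) \sum_(l < c.+1)
     f i j k l * g (n - i)%N (a - j)%N (b - k)%N (c - l)%N.
Definition fpow (f : fps) (k : nat) : fps := iter k (fmul f) fone.
(* 1/(1-h) = sum_k h^k, for h with zero constant term (the sum is then
   finite coefficientwise: h^k has total degree >= k) *)
Definition fgeom (h : fps) : fps := fun n a b c =>
  \sum_(k < (n + a + b + c).+1) fpow h k n a b c.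
(* division by z^l (exact when f is divisible by z^l) *)
Definition fdivz (l : nat) (f : fps) : fps := fun n a b c => f (n + l)%N a b c.
Definition fz (g : nat -> R) : fps := fun n a b c =>
  if [&& a == 0%N, b == 0%N & c == 0%N] then g n else 0.
Definition fzt (g : nat -> R) : fps := fun n a b c =>
  if [&& a == 0%N, b == n & c == 0%N] then g n else 0.
End Series.

Section Words.
Variables (R : comNzRingType) (A : finType) (p : A -> R) (w : seq A).

Definition ell := size w.
Definition Pw (s : seq A) : R := \prod_(a <- s) p a.
Definition pi_w : R := Pw w.

Definition gfc (L : seq A -> Prop) (n : nat) : R :=
  \sum_(s : n.-tuple A | pb (L s)) Pw s.

Definition inCo (e : seq A) : Prop :=
  (0 < size e)%N /\ (size e < ell)%N /\
  exists e' : seq A, (0 < size e')%N /\ w ++ e = e' ++ w.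
Definition inC (e : seq A) : Prop := e = [::] \/ inCo e.
Definition inK (e : seq A) : Prop :=
  inCo e /\ ~ (exists e1 e2 : seq A, inCo e1 /\ (0 < size e2)%N /\ e = e1 ++ e2).

Definition inRl (r : seq A) : Prop :=
  (exists x, r = x ++ w) /\
  ~ (exists x y : seq A, r = x ++ w ++ y /\ (0 < size y)%N).
Definition inMl (m : seq A) : Prop :=
  (0 < size m)%N /\ (exists x, w ++ m = x ++ w) /\
  ~ (exists x y : seq A, w ++ m = x ++ w ++ y /\ (0 < size x)%N /\ (0 < size y)%N).
Definition inUl (u : seq A) : Prop :=
  ~ (exists x y : seq A, w ++ u = x ++ w ++ y /\ (0 < size x)%N).
Definition inNl (s : seq A) : Prop :=
  ~ (exists x y : seq A, s = x ++ w ++ y).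
Definition inwCstar (s : seq A) : Prop :=
  exists es : seq (seq A), (forall e, e \in es -> inC e) /\ s = w ++ flatten es.

Definition occb (T : seq A) (i : nat) : bool := take ell (drop i T) == w.
Definition occ (T : seq A) : nat := #|[pred i : 'I_(size T) | occb T i]|.
Definition cov (T : seq A) : nat :=
  #|[pred j : 'I_(size T) |
      [exists i : 'I_(size T), occb T i && (i <= j < i + ell)%N]]|.
Definition overlap (T : seq A) : rel 'I_(size T) := fun i j =>
  [&& occb T i, occb T j, (i < j + ell)%N & (j < i + ell)%N].
Arguments overlap : clear implicits.
Definition cl (T : seq A) : nat := n_comp (overlap T) [pred i : 'I_(size T) | occb T i].

Definition Gser : fps R := fun n a b c =>
  \sum_(T : n.-tuple A | [&& occ T == a, cov T == b & cl T == c]) Pw T.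

Definition Rser := fz (gfc inRl).
Definition Mser := fz (gfc inMl).
Definition User := fz (gfc inUl).
Definition Nser := fz (gfc inNl).
Definition Kser := fz (gfc inK).
End Words.

Section Thm.
Variables (R : fieldType) (A : finType) (p : A -> R) (w : seq A).

Definition frakK : fps R :=
  fmul (fmon (pi_w p w) (ell w) 1 (ell w) 0)
       (fgeom (fmul (fmon 1 0 1 0 0) (fzt (gfc p (inK w))))).

Definition Fsub (y : fps R) : fps R :=
  fadd (Nser p w)
    (fmul (fmul (fmul (fscale (pi_w p w)^-1 (fdivz (ell w) (Rser p w))) y)
                (fgeom (fmul (fscale (pi_w p w)^-1
                                (fdivz (ell w) (fsub (Mser p w) (Kser p w)))) y)))
          (User p w)).

Definition clumpSer : fps R := fun n a b c =>
  if (b == n) && (c == 0%N) then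
    \sum_(s : n.-tuple A | pb (inwCstar w s) && (occ w s == a)) Pw p s
  else 0.
End Thm.

(* Main.v *)
(** Cut a text after each occurrence of [w]: it is a word of R, followed by words
    of M, followed by a word of U.  A step [m] in M leads from one occurrence to
    the next one.  If [|m| < |w|], then [m] lies in K, the two occurrences overlap,
    the clump goes on and [|m|] new positions are covered; otherwise [|w|] new
    positions are covered and a new clump starts.  The statistics are thus additive
    along the steps, and the series E of the texts ending with [w] satisfies
      E = u x t^l R(z) + E (x K(zt) + u x t^l (M(z) - K(z))),    G = N + E U.
    Solving this linear equation and grouping the K-steps into the geometric series
    of frakK gives F(z, u frakK). *)
Require Import Defs.
From HB Require Import structures.
From mathcomp Require Import all_boot all_order all_algebra.
From mathcomp Require Import boolp zify ring.
From Stdlib Require Import ClassicalEpsilon.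
Set Implicit Arguments. Unset Strict Implicit. Unset Printing Implicit Defensive.
Import Order.TTheory GRing.Theory Num.Theory.
Local Open Scope ring_scope.

(** * Formal power series *)

Definition pseries (S : Type) := nat -> S.

HB.instance Definition _ (S : Type) := gen_eqMixin (pseries S).
HB.instance Definition _ (S : Type) := gen_choiceMixin (pseries S).

Section PowerSeriesZmod.
Variable S : zmodType.
Implicit Types f g h : pseries S.

Definition ps_zero : pseries S := fun=> 0.
Definition ps_opp f : pseries S := fun n => - f n.
Definition ps_add f g : pseries S := fun n => f n + g n.

Fact ps_addA : associative ps_add.
Proof. by move=> f g h; apply: funext => n; rewrite /ps_add addrA. Qed.
Fact ps_addC : commutative ps_add.
Proof. by move=> f g; apply: funext => n; rewrite /ps_add addrC. Qed.
Fact ps_add0 : left_id ps_zero ps_add.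
Proof. by move=> f; apply: funext => n; rewrite /ps_add add0r. Qed.
Fact ps_addN : left_inverse ps_zero ps_opp ps_add.
Proof. by move=> f; apply: funext => n; rewrite /ps_add /ps_opp addNr. Qed.

HB.instance Definition _ :=
  GRing.isZmodule.Build (pseries S) ps_addA ps_addC ps_add0 ps_addN.

Lemma ps_addE f g n : (f + g) n = f n + g n. Proof. by []. Qed.

Lemma ps_sumE I (r : seq I) (P : pred I) (F : I -> pseries S) n :
  (\sum_(i <- r | P i) F i) n = \sum_(i <- r | P i) F i n.
Proof. by elim/big_rec2: _ => // i y x _ <-. Qed.

End PowerSeriesZmod.

Section PowerSeriesRing.
Variable S : comNzRingType.
Implicit Types f g h : pseries S.

Definition ps_mono i (s : S) : pseries S := fun n => if n == i then s else 0.
Definition ps_mul f g : pseries S := fun n => \sum_(i < n.+1) f i * g (n - i)%N.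

(* Products of power series are computed in polynomials, which transfers
   associativity and commutativity from [{poly S}]. *)
Lemma ps_mul_trunc f g n m : (n <= m)%N ->
  ps_mul f g n = (\poly_(i < m.+1) f i * \poly_(i < m.+1) g i)`_n.
Proof.
move=> nm; rewrite coefM; apply: eq_bigr => i _.
have := ltn_ord i; rewrite ltnS => ile.
rewrite !coef_poly !ltnS (leq_trans ile nm).
by rewrite (leq_trans (leq_subr _ _) nm).
Qed.

Fact ps_mulC : commutative ps_mul.
Proof.
by move=> f g; apply: funext => n; rewrite !(@ps_mul_trunc _ _ n n) // mulrC.
Qed.

Fact ps_mulA : associative ps_mul.
Proof.
move=> f g h; apply: funext => n; rewrite (ps_mulC f) (ps_mulC (ps_mul f g)).
rewrite /ps_mul; under eq_bigr => i _.
  rewrite -/(ps_mul g h i) (@ps_mul_trunc g h i n); last by rewrite -ltnS.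
  over.
rewrite [RHS](_ : _ = (\poly_(i < n.+1) h i *
   (\poly_(i < n.+1) f i * \poly_(i < n.+1) g i))`_n); last first.
  rewrite coefM; apply: eq_bigr => i _; rewrite coef_poly ltn_ord; congr (_ * _).
  exact: ps_mul_trunc (leq_subr _ _).
rewrite (_ : \poly_(i < n.+1) h i * _ = \poly_(i < n.+1) g i *
  \poly_(i < n.+1) h i * \poly_(i < n.+1) f i); last by ring.
by rewrite coefM; apply: eq_bigr => i _; rewrite coef_poly ltnS leq_subr.
Qed.

Fact ps_mul1 : left_id (ps_mono 0 1) ps_mul.
Proof.
move=> f; apply: funext => n; rewrite /ps_mul big_ord_recl big1 ?addr0 /=.
  by rewrite /ps_mono eqxx mul1r subn0.
by move=> i _; rewrite /ps_mono /= mul0r.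
Qed.

Fact ps_mulDl : left_distributive ps_mul (@ps_add S).
Proof.
move=> f g h; apply: funext => n; rewrite /ps_mul /ps_add -big_split.
by apply: eq_bigr => i _; rewrite mulrDl.
Qed.

Fact ps_one_neq0 : ps_mono 0 1 != @ps_zero S.
Proof.
by apply/eqP => /(congr1 (fun f => f 0%N)); apply/eqP; rewrite oner_neq0.
Qed.

HB.instance Definition _ := GRing.Zmodule_isComNzRing.Build (pseries S)
  ps_mulA ps_mulC ps_mul1 ps_mulDl ps_one_neq0.

Lemma ps_mulE f g n : (f * g) n = \sum_(i < n.+1) f i * g (n - i)%N.
Proof. by []. Qed.

Lemma ps_mul_monoE i s f n :
  (ps_mono i s * f) n = if (i <= n)%N then s * f (n - i)%N else 0.
Proof.
rewrite ps_mulE; case: leqP => ni.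
  rewrite (bigD1 (Ordinal (ni : (i < n.+1)%N))) //= /ps_mono eqxx big1 ?addr0 //.
  by move=> j /negbTE; rewrite -val_eqE /= => ->; rewrite mul0r.
rewrite big1 // => j _; rewrite /ps_mono.
by case: eqP => [ji|_]; rewrite ?mul0r //; have := ltn_ord j; lia.
Qed.

Lemma ps_monoM i j s t : ps_mono i s * ps_mono j t = ps_mono (i + j) (s * t).
Proof.
apply: funext => n; rewrite ps_mul_monoE /ps_mono.
case: leqP => ni; last by case: eqP => //; lia.
have -> : (n - i == j)%N = (n == i + j)%N by lia.
by case: eqP => //; rewrite mulr0.
Qed.

End PowerSeriesRing.

(** The outermost variable is z, followed by x, t and u. Unfolding [ps4 R] gives the function type
    [fps R], so the series of the statement are elements of this commutative ring without any
    conversion. *)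
Definition ps3 (R : Type) := pseries (pseries (pseries R)).
Definition ps4 (R : Type) := pseries (ps3 R).
HB.instance Definition _ (R : comNzRingType) := GRing.ComNzRing.on (ps3 R).
HB.instance Definition _ (R : comNzRingType) := GRing.ComNzRing.on (ps4 R).

Section Monomials.
Variable R : comNzRingType.

Definition mon (r : R) (a b c : nat) : ps3 R := ps_mono a (ps_mono b (ps_mono c r)).

Lemma monE r a b c j k l :
  mon r a b c j k l = if [&& j == a, k == b & l == c] then r else 0.
Proof. by rewrite /mon /ps_mono; case: eqP => //; case: eqP => //; case: eqP. Qed.

Lemma monM r s a b c a' b' c' :
  mon r a b c * mon s a' b' c' = mon (r * s) (a + a') (b + b') (c + c').
Proof. by rewrite /mon [LHS]ps_monoM ps_monoM ps_monoM. Qed.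

Lemma fmonE r i a b c : fmon r i a b c = ps_mono i (mon r a b c) :> ps4 R.
Proof.
apply: funext => n; apply: funext => j; apply: funext => k; apply: funext => l.
rewrite /fmon /ps_mono; case: (n == i) => //=.
by rewrite monE.
Qed.

Lemma fmonM r s i j a b c a' b' c' :
  (fmon r i a b c : ps4 R) * (fmon s j a' b' c' : ps4 R) =
  fmon (r * s) (i + j) (a + a') (b + b') (c + c').
Proof. by rewrite !fmonE ps_monoM monM. Qed.

Lemma foneE : fone R = 1 :> ps4 R.
Proof. by rewrite /fone fmonE. Qed.

Lemma fmulE (f g : ps4 R) : fmul f g = f * g.
Proof.
apply: funext => n; apply: funext => a; apply: funext => b; apply: funext => c.
rewrite /fmul ps_mulE !ps_sumE; apply: eq_bigr => i _.
rewrite ps_mulE !ps_sumE; apply: eq_bigr => j _.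
rewrite ps_mulE !ps_sumE; apply: eq_bigr => k _.
by rewrite ps_mulE.
Qed.

Lemma fpowE (f : ps4 R) k : fpow f k = f ^+ k.
Proof.
elim: k => [|k IHk]; first by rewrite expr0 -foneE.
by rewrite exprS -IHk -fmulE.
Qed.

(** In the product of [h] with a power of [h], the term taking the constant coefficient of [h]
    vanishes. Every other term leaves the power a strictly smaller total degree. *)
Lemma fpow_low (h : ps4 R) k n a b c : h 0%N 0%N 0%N 0%N = 0 ->
  (n + a + b + c < k)%N -> fpow h k n a b c = 0.
Proof.
move=> h0; elim: k n a b c => // k IHk n a b c lt.
rewrite /fpow iterS -/(fpow h k) /fmul.
rewrite big1 // => i _; rewrite big1 // => j _.
rewrite big1 // => i' _; rewrite big1 // => j' _.
have [/andP[/andP[/eqP-> /eqP->] /andP[/eqP-> /eqP->]]|nz] :=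
    boolP (((i == 0 :> nat) && (j == 0 :> nat)) &&
           ((i' == 0 :> nat) && (j' == 0 :> nat)))%N.
  by rewrite h0 mul0r.
rewrite IHk ?mulr0 //.
have := ltn_ord i; have := ltn_ord j; have := ltn_ord i'; have := ltn_ord j'.
by move: nz; lia.
Qed.

(** The range of the sum in [fgeom] depends on the coefficient. A common bound [N] makes all
    coefficients of low total degree come from one finite sum in the ring. *)
Lemma fgeom_trunc (h : ps4 R) N n a b c : h 0%N 0%N 0%N 0%N = 0 ->
  (n + a + b + c < N)%N ->
  fgeom h n a b c = ((\sum_(k < N) h ^+ k) : ps4 R) n a b c.
Proof.
move=> h0 lt; rewrite /fgeom !ps_sumE.
rewrite (big_ord_widen _ (fun k => fpow h k n a b c) lt) big_mkcond.
apply: eq_bigr => k _; rewrite -fpowE; case: ltnP => // le.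
by rewrite fpow_low.
Qed.

(** A fixed coefficient of the product involves only coefficients of [fgeom h] of no larger total
    degree, where a finite geometric sum can replace it. Telescoping then leaves 1 minus a power of
    [h] whose degree is too high to contribute. *)
Lemma fgeomP (h : ps4 R) : h 0%N 0%N 0%N 0%N = 0 ->
  (1 - h) * (fgeom h : ps4 R) = 1.
Proof.
move=> h0.
apply: funext => n; apply: funext => a; apply: funext => b; apply: funext => c.
pose N := (n + a + b + c)%N.
transitivity (((1 - h) * \sum_(k < N.+1) h ^+ k : ps4 R) n a b c).
  rewrite -!fmulE /fmul.
  apply: eq_bigr => i _; apply: eq_bigr => j _.
  apply: eq_bigr => k _; apply: eq_bigr => l _.
  by rewrite (@fgeom_trunc _ N.+1) // /N; lia.
have -> : (1 - h) * (\sum_(k < N.+1) h ^+ k) = 1 - h ^+ N.+1.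
  by rewrite -[1 - _]opprB mulNr -subrX1 opprB.
by rewrite -fpowE [LHS](_ : _ = (1 : ps4 R) n a b c - fpow h N.+1 n a b c) //
  fpow_low // subr0.
Qed.

End Monomials.

(** * Counting components of the overlap relation *)

Lemma pbP (P : Prop) : reflect P (pb P).
Proof. by rewrite /pb; case: excluded_middle_informative => ?; constructor. Qed.

Lemma card_ord_count n (P : pred nat) :
  #|[pred i : 'I_n | P i]| = count P (iota 0 n).
Proof.
rewrite cardE size_filter -val_enum_ord count_map enumT.
exact: eq_count.
Qed.

Lemma count_pred0_in (T : eqType) (a : pred T) s :
  {in s, forall x, ~~ a x} -> count a s = 0%N.
Proof.
by move=> as0; rewrite (eq_in_count (a2 := pred0)) ?count_pred0 // => x /as0/negbTE.
Qed.

Lemma count_leq_iota q a n : count (leq q) (iota a n) = (a + n - maxn q a)%N.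
Proof. by elim: n a => [|n IHn] a /=; [lia | rewrite IHn; case: leqP; lia]. Qed.

Lemma count_eq_iota q n : (q < n)%N -> count (pred1 q) (iota 0 n) = 1%N.
Proof. by move=> qn; rewrite count_uniq_mem ?iota_uniq // mem_iota qn. Qed.

(** Meant for a text prolonged by one step: [q] is the position of the new occurrence, and [b] tells
    whether it is counted. It serves for occurrences ([b] true) and for clumps. *)
Lemma count_iota_extend (f g : pred nat) m n q (b : bool) :
  (q < m + n)%N -> (forall i, f i -> i < m)%N -> f q = false ->
  g =1 (fun i => f i || ((i == q) && b)) ->
  count g (iota 0 (m + n)) = (count f (iota 0 m) + b)%N.
Proof.
move=> qn fm fq gE; pose h i := (i == q) && b.
have -> : count f (iota 0 m) = count f (iota 0 (m + n)).
  rewrite iotaD count_cat [X in _ = (_ + X)%N]count_pred0_in ?addn0 // => i.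
  by rewrite mem_iota => ge; apply/negP => /fm; lia.
have -> : b = count h (iota 0 (m + n)) :> nat.
  rewrite /h; case: b {gE h}; last first.
    by rewrite (eq_count (a2 := pred0)) ?count_pred0 // => i; rewrite andbF.
  transitivity (count (pred1 q) (iota 0 (m + n))); first by rewrite count_eq_iota.
  by apply: eq_count => i; rewrite /= andbT.
have fh0 : count (predI f h) (iota 0 (m + n)) = 0%N.
  by apply: count_pred0_in => i _ /=; rewrite /h; case: eqP => [->|_]; rewrite ?fq //= andbF.
by rewrite (eq_count (gE : g =1 predU f h)) -count_predUI fh0 addn0.
Qed.

Section Leaders.
Local Open Scope nat_scope.
Variables (n l : nat) (f : pred nat).

(** For [f] the occurrence predicate, this singles out the leftmost occurrence of each clump. *)
Definition leader i := f i && ~~ has (fun k => f k && (i < k + l)) (iota 0 i).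

Lemma leaderP i : reflect (f i /\ forall k, k < i -> f k -> k + l <= i) (leader i).
Proof.
apply: (iffP andP) => [[fi /hasPn H]|[fi H]]; split=> //.
  by move=> k ki fk; have := H k; rewrite mem_iota fk /=; lia.
by apply/hasPn => k; rewrite mem_iota => ki; case fk: (f k) => //=; have := H k; lia.
Qed.

Let e : rel 'I_n := fun i j => [&& f i, f j, i < j + l & j < i + l].

(** Every component contains exactly one leader: going back to earlier overlapping positions must
    stop at one, and two leaders are never connected. *)
Lemma n_comp_leader : n_comp e [pred i : 'I_n | f i] = count leader (iota 0 n).
Proof.
have sym_e : symmetric e by move=> i j; rewrite /e andbCA; congr [&& _, _ & _]; exact: andbC.
have csym := sym_connect_sym sym_e.
(* An interval starting before a leader [j] ends by [j], so the positions below [j] are closed under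
   overlap. *)
have sep (i j : 'I_n) : i < j -> leader j -> connect e i j -> False.
  move=> ij /leaderP[fj lj] cij.
  have clj : closed e [pred k : 'I_n | k < j].
    apply: (intro_closed csym) => x y /and4P[fx fy _ yx]; rewrite !inE => xj.
    by have := lj x xj fx; lia.
  by have := closed_connect clj cij; rewrite !inE ij ltnn.
have clf : closed e [pred i : 'I_n | f i].
  by move=> x y /and4P[fx fy _ _]; rewrite !inE fx fy.
have ex (i : 'I_n) : f i -> exists2 j : 'I_n, leader j & connect e i j.
  have [m] := ubnP (i : nat); elim: m i => // m IHm i im fi.
  case li: (leader i); first by exists i.
  move: li; rewrite /leader fi /= => /negbFE/hasP[k].
  rewrite mem_iota add0n => ki /andP[fk ikl].
  have kn : k < n by apply: ltn_trans (ltn_ord i).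
  have [|//|j lj cj] := IHm (Ordinal kn); first by rewrite /=; lia.
  exists j => //; apply: connect_trans cj; apply: connect1.
  by rewrite /e fi fk ikl /=; lia.
(* [fingraph.root] maps the leaders injectively onto the representatives of the components. *)
rewrite -card_ord_count /n_comp_mem.
rewrite -(card_in_image (f := fingraph.root e) (A := [pred i : 'I_n | leader i])).
  apply: eq_card => r; rewrite !inE; apply/andP/imageP.
    case=> rr fr; have [j lj cj] := ex r fr; exists j => //.
    by rewrite -(fingraph.rootP csym cj); apply/esym/eqP.
  case=> j; rewrite inE => /leaderP[fj _] ->.
  rewrite roots_root //; split=> //.
  by rewrite [f _](_ : _ = (fingraph.root e j \in [pred i : 'I_n | f i])) //
    -(closed_connect clf (connect_root e j)) inE.
move=> i j; rewrite !inE => li lj /(fingraph.rootP csym) cij; apply: val_inj.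
case: (ltngtP i j) => // [ij|ji]; first by case: (sep _ _ ij lj cij).
by case: (sep _ _ ji li); rewrite csym.
Qed.
End Leaders.

(** * Occurrences and the languages R, M, U, N, K *)

(* [lia] compares atoms syntactically, and [size] occurs with the carrier of [A]
   reached through two different coercion paths. *)
Ltac size_lia A :=
  unfold ell in *; try change (Equality.sort A) with (Finite.sort A) in *; lia.

Section Occurrences.
Local Open Scope nat_scope.
Variables (A : finType) (w : seq A).
Hypothesis w_gt0 : 0 < size w.
Local Notation l := (size w).
Implicit Types s v T : seq A.

Local Ltac slia := size_lia A.

Lemma occb_bound T i : occb w T i -> i + l <= size T.
Proof.
move=> /eqP/(congr1 size); rewrite size_take size_drop /ell.
by case: ltnP; slia.
Qed.

Lemma occbP T i :
  reflect (exists x y, T = x ++ w ++ y /\ size x = i) (occb w T i).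
Proof.
apply: (iffP idP) => [o|[x [y [-> <-]]]]; last first.
  by rewrite /occb drop_size_cat // take_size_cat.
exists (take i T), (drop (i + l) T); rewrite size_takel; last first.
  by have := occb_bound o; slia.
split=> //; move/eqP: o => {1}<-.
by rewrite addnC -drop_drop cat_take_drop cat_take_drop.
Qed.

Lemma occb_cat s v i : i + l <= size s -> occb w (s ++ v) i = occb w s i.
Proof.
move=> il; rewrite /occb drop_cat /ell.
have -> : i < size s by slia.
by rewrite takel_cat // size_drop; slia.
Qed.

Lemma suffix_occb T : suffix w T = (l <= size T) && occb w T (size T - l).
Proof.
apply/suffixP/andP => [[x ->]|[lT /occbP[x [y [eT sx]]]]].
  rewrite size_cat addnK; split; first by slia.
  by apply/occbP; exists x, [::]; rewrite cats0.
exists x; move: lT sx; rewrite eT !size_cat => lT sx.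
by rewrite (size0nil (s := y)) ?cats0 //; slia.
Qed.

Lemma suffix_take T k : k <= size T ->
  suffix w (take k T) = (l <= k) && occb w T (k - l).
Proof.
move=> kT; rewrite suffix_occb size_takel //; case: (leqP l k) => //= lk.
by rewrite -{2}(cat_take_drop k T) occb_cat ?size_takel //; slia.
Qed.

(** M and U are defined through the word w v. This shift transfers their conditions to any text
    [s ++ v] where [s] ends with w. *)
Lemma occb_suffix_cat s v i : suffix w s ->
  occb w (w ++ v) i = occb w (s ++ v) (size s - l + i).
Proof.
by case/suffixP => x ->; rewrite size_cat addnK -catA /occb addnC -drop_drop
  [drop (size x) _]drop_size_cat.
Qed.

Lemma occb_suffix_catP s v x y : suffix w s -> w ++ v = x ++ w ++ y ->
  occb w (s ++ v) (size s - l + size x).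
Proof. by move=> ws e; rewrite -occb_suffix_cat //; apply/occbP; exists x, y. Qed.

Lemma occb_suffix_cat_inv s v i : suffix w s -> occb w (s ++ v) i ->
  size s <= i + l -> exists x y, w ++ v = x ++ w ++ y /\
    size x = i + l - size s /\ size y = size (s ++ v) - (i + l).
Proof.
move=> ws oi ge; have ls := size_suffix ws; have := occb_bound oi.
have : occb w (w ++ v) (i + l - size s).
  by rewrite (occb_suffix_cat _ _ ws) (_ : size s - l + _ = i) //; slia.
case/occbP => x [y [e sx]]; exists x, y; do 2!split => //.
by have := congr1 size e; rewrite !size_cat; slia.
Qed.

(** An occurrence in w v that does not start at 0 is one in [s ++ v] ending beyond [s]. This and the
    next three lemmas express the languages by positions of occurrences, the form used in all later
    arguments. *)
Lemma inUl_occ s v : suffix w s ->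
  inUl w v <-> forall i, occb w (s ++ v) i -> i + l <= size s.
Proof.
move=> ws; have ls := size_suffix ws; split.
  move=> U i oi; rewrite leqNgt; apply/negP => gt; apply: U.
  have [|x [y [-> [sx _]]]] := occb_suffix_cat_inv ws oi; first by slia.
  by exists x, y; split => //; slia.
move=> H [x [y [e x0]]].
by have := H _ (occb_suffix_catP ws e); slia.
Qed.

Lemma inMl_occ s v : suffix w s ->
  inMl w v <-> [/\ 0 < size v, suffix w (s ++ v) & forall i,
    occb w (s ++ v) i -> i + l <= size s \/ i + l = size (s ++ v)].
Proof.
move=> ws; have ls := size_suffix ws; split.
  case=> v0 [[x e] M]; split => //.
    rewrite suffix_occb size_cat; apply/andP; split; first by slia.
    have := @occb_suffix_catP s v x [::] ws; rewrite cats0 => /(_ e).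
    have := congr1 size e; rewrite !size_cat => sx.
    by rewrite (_ : size s - l + _ = size s + size v - l) //; slia.
  move=> i oi; case: (leqP (i + l) (size s)) => [|gt]; [by left | right].
  have [|x' [y' [e' [sx sy]]]] := occb_suffix_cat_inv ws oi; first by slia.
  have := occb_bound oi.
  case: (posnP (size y')) => y0 le; first by slia.
  by case: M; exists x', y'; split => //; split => //; slia.
case=> v0 wsv H; split => //; split.
  move: wsv; rewrite suffix_occb size_cat => /andP[_ o].
  have [|x' [y' [e' [sx sy]]]] := occb_suffix_cat_inv ws o; first by slia.
  exists x'; rewrite e' (size0nil (s := y')) ?cats0 //.
  by rewrite sy size_cat; slia.
move=> [x [y [e [x0 y0]]]].
have := H _ (occb_suffix_catP ws e); have := congr1 size e.
by rewrite !size_cat; slia.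
Qed.

Lemma inRl_occ v :
  inRl w v <-> suffix w v /\ forall i, occb w v i -> i + l = size v.
Proof.
split=> [[wv R]|[/suffixP wv H]]; split=> //.
- by apply/suffixP.
- move=> i oi; have := occb_bound oi; case/occbP: oi => x [y [e <-]] _.
  case: (posnP (size y)) => y0; last by case: R; exists x, y.
  by rewrite e !size_cat y0 addn0.
move=> [x [y [e y0]]]; have /H : occb w v (size x) by apply/occbP; exists x, y.
by rewrite e !size_cat; slia.
Qed.

Lemma inNl_occ v : inNl w v <-> forall i, ~~ occb w v i.
Proof.
split=> [N i|H [x [y e]]].
  by apply/negP => /occbP[x [y [e _]]]; apply: N; exists x, y.
by have /negP := H (size x); apply; apply/occbP; exists x, y.
Qed.

(** Splitting off a proper prefix of [v] that lies in [inCo] amounts to finding an occurrence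
    strictly between the first and the last one of w v. The length bound is what makes these two
    overlap. *)
Lemma inK_inMl v : inK w v <-> inMl w v /\ size v < l.
Proof.
split.
  case=> -[v0 [vl [x [x0 e]]]] K; split=> //; split=> //; split; first by exists x.
  move=> [x1 [y1 [e1 [x10 y10]]]]; apply: K.
  have := congr1 size e1; rewrite !size_cat => sz.
  (* The intermediate occurrence starts at [size x1], hence ends after [size x1] letters of [v]:
     this is where [v] is cut. *)
  have ev : v = take (size x1) v ++ drop (size x1) v by rewrite cat_take_drop.
  exists (take (size x1) v), (drop (size x1) v); split; last split => //.
  - split; first by rewrite size_takel; slia.
    split; first by rewrite size_takel /ell; slia.
    exists x1; split => //; move: e1; rewrite {1}ev !catA => /eqP.
    by rewrite eqseq_cat ?size_cat ?size_takel; [case/andP => /eqP | slia | slia].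
  by rewrite size_drop; slia.
case=> -[v0 [[x e] M]] vl; have := congr1 size e; rewrite !size_cat => sz.
split; first by do 2!split => //; exists x; split=> //; slia.
case=> e1 [e2 [[e10 [e1l [x1 [x10 ex1]]]] [e20 ev]]]; apply: M.
by exists x1, e2; rewrite ev catA ex1 -catA.
Qed.

(** * Effect of the languages on the three statistics *)

Lemma occE T : occ w T = count (occb w T) (iota 0 (size T)).
Proof. exact: card_ord_count. Qed.

Lemma clE T : cl w T = count (leader l (occb w T)) (iota 0 (size T)).
Proof. exact: n_comp_leader. Qed.

(** The search stops at [j] rather than at the end of the text, so texts of different lengths can be
    compared position by position. *)
Definition covered (f : pred nat) j := has (fun i => f i && (j < i + l)) (iota 0 j.+1).

Lemma coveredP (f : pred nat) j :
  reflect (exists2 i, f i & i <= j < i + l) (covered f j).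
Proof.
apply: (iffP hasP) => [[i]|[i fi ij]].
  by rewrite mem_iota => ij /andP[fi jl]; exists i; slia.
by exists i; [rewrite mem_iota; slia | rewrite fi; slia].
Qed.

Lemma covE T : cov w T = count (covered (occb w T)) (iota 0 (size T)).
Proof.
rewrite -card_ord_count; apply: eq_card => j; rewrite !inE.
apply/existsP/coveredP => [[i /andP[oi ij]]|[i oi ij]]; first by exists i.
have iT : i < size T by have := occb_bound oi; slia.
by exists (Ordinal iT); rewrite /= oi.
Qed.

Lemma eq_leader (f g : pred nat) : f =1 g -> leader l f =1 leader l g.
Proof.
move=> fg i; rewrite /leader fg; congr (_ && ~~ _).
by apply: eq_has => k; rewrite fg.
Qed.

Lemma eq_covered (f g : pred nat) : f =1 g -> covered f =1 covered g.
Proof. by move=> fg j; apply: eq_has => k; rewrite fg. Qed.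

Lemma stat_inNl T : inNl w T -> [/\ occ w T = 0, cov w T = 0 & cl w T = 0].
Proof.
move=> /inNl_occ N; rewrite occE covE clE; split; apply: count_pred0_in => i _.
- exact: N.
- by apply/coveredP => -[j]; rewrite (negbTE (N j)).
by rewrite /leader (negbTE (N i)).
Qed.

Lemma stat_inRl T : inRl w T -> [/\ occ w T = 1, cov w T = l & cl w T = 1].
Proof.
move=> /inRl_occ[]; rewrite suffix_occb => /andP[lT o] H.
have eo : occb w T =1 pred1 (size T - l).
  move=> i /=; apply/idP/eqP => [/H|->//]; slia.
rewrite occE covE clE (eq_count eo) (eq_count (eq_leader eo)) (eq_count (eq_covered eo)).
split; first by rewrite count_eq_iota //; slia.
  rewrite -[RHS](_ : 0 + size T - maxn (size T - l) 0 = l) ?maxn0; last by slia.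
  rewrite -count_leq_iota; apply: eq_in_count => j; rewrite mem_iota => jT.
  by apply/coveredP/idP => [[i /eqP-> /andP[]//]|le]; exists (size T - l) => /=; slia.
rewrite -(@count_eq_iota (size T - l) (size T)); last by slia.
apply: eq_count => j; apply/leaderP/eqP => [[/eqP]//|->].
by split=> [|k + /eqP]; [exact: eqxx | slia].
Qed.

Lemma stat_inUl s v : suffix w s -> inUl w v ->
  [/\ occ w (s ++ v) = occ w s, cov w (s ++ v) = cov w s & cl w (s ++ v) = cl w s].
Proof.
move=> ws /(inUl_occ _ ws) U.
have eo : occb w (s ++ v) =1 occb w s.
  move=> i; case: (leqP (i + l) (size s)) => [/occb_cat->//|gt].
  by apply/idP/idP => [/U|/occb_bound]; slia.
have ob i : occb w s i -> i < size s by move/occb_bound; slia.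
rewrite !occE !covE !clE (eq_count eo) (eq_count (eq_leader eo)).
rewrite (eq_count (eq_covered eo)) size_cat iotaD !count_cat.
split; rewrite [X in _ + X]count_pred0_in ?addn0 // => i; rewrite mem_iota => ge.
- by apply/negP => /ob; slia.
- by apply/coveredP => -[j /occb_bound]; slia.
by apply/negP => /leaderP[/ob]; slia.
Qed.

(** The only new occurrence starts at |s| + |v| - l, while the previous one ends exactly at |s|. The
    new positions covered are those that lie in the new occurrence and beyond [s], and a clump
    starts exactly when the two occurrences are disjoint. *)
Lemma stat_inMl s v : suffix w s -> inMl w v ->
  [/\ occ w (s ++ v) = occ w s + 1, cov w (s ++ v) = cov w s + minn l (size v)
   & cl w (s ++ v) = cl w s + (l <= size v)].
Proof.
move=> ws /(inMl_occ _ ws)[v0 wsv M]; have ls := size_suffix ws.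
move: (wsv) (ws); rewrite !suffix_occb size_cat => /andP[_ oq] /andP[_ op].
set q := size s + size v - l in oq *.
have eo i : occb w (s ++ v) i = occb w s i || (i == q).
  case: (leqP (i + l) (size s)) => [le|gt].
    by rewrite occb_cat // [i == q](_ : _ = false) ?orbF //; apply/eqP; rewrite /q; slia.
  apply/idP/orP => [/M|[/occb_bound|/eqP->//]]; last by slia.
  by rewrite size_cat => -[|e]; [slia | right; apply/eqP; rewrite /q; slia].
have ob i : occb w s i -> i + l <= size s by move/occb_bound.
have osF : occb w s q = false by apply/negP => /ob; rewrite /q; slia.
have qn : q < size s + size v by rewrite /q; slia.
rewrite !occE !covE !clE size_cat.
have addq := @count_iota_extend _ _ (size s) (size v) q.
split.
- apply: (addq _ _ true) => //; first by move=> i /ob; slia.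
  by move=> i; rewrite eo andbT.
(* Inside [s], the new occurrence reaches only positions already covered by the final occurrence of
   [s]; beyond [s], the covered positions are those from [q] on. *)
- rewrite iotaD !count_cat; congr (_ + _).
    apply: eq_in_count => j; rewrite mem_iota => js.
    apply/coveredP/coveredP => -[i]; last by exists i; rewrite ?eo; try slia; apply/orP; left.
    rewrite eo => /orP[oi ij|/eqP-> ij]; first by exists i.
    by exists (size s - l) => //; rewrite /q in ij; slia.
  rewrite (@eq_in_count _ _ (leq q)) ?count_leq_iota; first by rewrite /q; slia.
  move=> j; rewrite mem_iota => js; apply/coveredP/idP => [[i]|qj].
    by rewrite eo => /orP[/ob|/eqP->]; slia.
  by exists q => //; rewrite /q; slia.
apply: addq => //.
- by move=> i /leaderP[/ob]; slia.
- by apply/negP => /leaderP[]; rewrite osF.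
move=> i; apply/leaderP/orP.
  rewrite eo => -[/orP[oi|/eqP ei] H].
    by left; apply/leaderP; split=> // k ki ok; apply: H => //; rewrite eo ok.
  (* Comparison with the final occurrence of [s], at [size s - l], forces |v| to be at least l. *)
  right; rewrite ei eqxx /=; have := H (size s - l); rewrite eo op ei /q /=; slia.
case=> [/leaderP[oi H]|/andP[/eqP-> lv]]; rewrite eo ?eqxx ?orbT.
  rewrite oi; split=> // k ki; rewrite eo => /orP[/H->//|/eqP ek].
  by have := ob _ oi; rewrite ek /q in ki *; slia.
by split=> // k kq; rewrite eo => /orP[/ob|/eqP]; rewrite /q in kq *; slia.
Qed.

End Occurrences.

(** * Unique factorizations *)

Section Decompositions.
Local Open Scope nat_scope.
Variables (A : finType) (w : seq A).
Hypothesis w_gt0 : 0 < size w.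
Local Notation l := (size w).
Implicit Types s v T e : seq A.

Local Ltac slia := size_lia A.

Lemma last_occurrence_split (q : nat) T : (exists2 i, occb w T i & i < q) ->
  exists s v, [/\ T = s ++ v, suffix w s, size s < q + l &
    forall i, occb w T i -> i < q -> i + l <= size s].
Proof.
case=> i0 o0 i0q; pose P i := occb w T i && (i < q).
have exP : exists i, P i by exists i0; rewrite /P o0.
have bP i : P i -> i <= size T by move=> /andP[/(occb_bound w_gt0)]; slia.
case: (ex_maxnP exP bP) => m /andP[om mq] mmax.
have bm := occb_bound w_gt0 om.
exists (take (m + l) T), (drop (m + l) T); rewrite cat_take_drop; split=> //.
- by rewrite suffix_take // addnK om andbT leq_addl.
- by rewrite size_takel //; slia.
move=> i oi iq; rewrite size_takel // leq_add2r; apply: mmax.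
by rewrite /P oi.
Qed.

Lemma occb_end_cat s v : suffix w s -> occb w (s ++ v) (size s - l).
Proof.
move=> ws; have ls := size_suffix ws.
by rewrite occb_cat //; [move: ws; rewrite suffix_occb // => /andP[] | slia].
Qed.

Lemma text_split T : inNl w T \/ exists s v, [/\ T = s ++ v, suffix w s & inUl w v].
Proof.
have [ex|nex] := pselect (exists2 i, occb w T i & i < size T).
  right; have [s [v [eT ws _ H]]] := last_occurrence_split ex.
  exists s, v; split => //; apply/(inUl_occ w_gt0 _ ws) => i; rewrite -eT => oi.
  by apply: H => //; have := occb_bound w_gt0 oi; slia.
left; apply/(inNl_occ w_gt0) => i; apply/negP => oi; apply: nex.
by exists i => //; have := occb_bound w_gt0 oi; slia.
Qed.

(** Each cut is the end of an occurrence, and no occurrence ends after the other cut, so neither cut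
    exceeds the other. *)
Lemma text_split_uniq s v s' v' : suffix w s -> inUl w v -> suffix w s' ->
  inUl w v' -> s ++ v = s' ++ v' -> size s = size s'.
Proof.
move=> ws /(inUl_occ w_gt0 _ ws) U ws' /(inUl_occ w_gt0 _ ws') U' e.
have ls := size_suffix ws; have ls' := size_suffix ws'.
have := occb_end_cat v ws; have := occb_end_cat v' ws'.
by rewrite -{1}e {2}e => /U ? /U'; slia.
Qed.

Lemma suffix_split T : suffix w T ->
  inRl w T \/ exists s v, [/\ T = s ++ v, suffix w s & inMl w v].
Proof.
move=> wT; have lT := size_suffix wT.
have [ex|nex] := pselect (exists2 i, occb w T i & i < size T - l).
  right; have [s [v [eT ws sq H]]] := last_occurrence_split ex.
  exists s, v; split => //; apply/(inMl_occ w_gt0 _ ws); rewrite -eT; split=> //.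
    by have := congr1 size eT; rewrite size_cat; slia.
  move=> i oi; have bi := occb_bound w_gt0 oi.
  by case: (ltnP i (size T - l)) => iq; [left; exact: H | right; slia].
left; apply/(inRl_occ w_gt0); split=> // i oi; have bi := occb_bound w_gt0 oi.
case: (ltnP i (size T - l)) => iq; last by slia.
by case: nex; exists i.
Qed.

(** The occurrence ending at one cut is not the final one, because a nonempty M-word follows; it
    therefore ends no later than the other cut. *)
Lemma suffix_split_uniq s v s' v' : suffix w s -> inMl w v -> suffix w s' ->
  inMl w v' -> s ++ v = s' ++ v' -> size s = size s'.
Proof.
move=> ws /(inMl_occ w_gt0 _ ws)[v0 _ M] ws' /(inMl_occ w_gt0 _ ws')[v0' _ M'] e.
have ls := size_suffix ws; have ls' := size_suffix ws'.
have := occb_end_cat v ws; have := occb_end_cat v' ws'.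
rewrite -{1}e {2}e => /M + /M'; have := congr1 size e; rewrite !size_cat.
slia.
Qed.

Lemma suffix_cat_inMl s v : suffix w s -> inMl w v -> suffix w (s ++ v).
Proof. by move=> ws /(inMl_occ w_gt0 _ ws)[]. Qed.

Lemma suffix_cat_notin_inRl s v : suffix w s -> 0 < size v -> ~ inRl w (s ++ v).
Proof.
move=> ws v0 /(inRl_occ w_gt0)[_ /(_ _ (occb_end_cat v ws))].
by have := size_suffix ws; rewrite size_cat; slia.
Qed.

Lemma suffix_cat_notin_inNl s v : suffix w s -> ~ inNl w (s ++ v).
Proof. by move=> ws /(inNl_occ w_gt0)/(_ (size s - l)); rewrite occb_end_cat. Qed.

(** * Clump words *)

Lemma inwCstar_nil : inwCstar w w.
Proof. by exists [::]; rewrite cats0. Qed.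

Lemma inwCstar_cat s e : inwCstar w s -> inC w e -> inwCstar w (s ++ e).
Proof.
move=> [es [H ->]] Ce; exists (rcons es e); rewrite flatten_rcons catA.
by split=> // x; rewrite mem_rcons inE => /predU1P[->//|/H].
Qed.

(** Empty factors do not change the word, so the induction step need only treat factors in
    [inCo]. *)
Lemma inwCstar_ind (P : seq A -> Prop) : P w ->
  (forall s e, inwCstar w s -> P s -> inCo w e -> P (s ++ e)) ->
  forall T, inwCstar w T -> P T.
Proof.
move=> Pw0 PS T [es [H ->]]; elim/last_ind: es H => [|es e IH] H.
  by rewrite cats0.
have Hes e' : e' \in es -> inC w e' by move=> ees; apply: H; rewrite mem_rcons inE ees orbT.
rewrite flatten_rcons catA.
case: (H e) => [|->|Ce]; first by rewrite mem_rcons mem_head.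
  by rewrite cats0; exact: IH.
by apply: PS => //; [exists es | exact: IH].
Qed.

Lemma inwCstar_suffix T : inwCstar w T -> suffix w T.
Proof.
elim/inwCstar_ind => [|s e _ /suffixP[x ->] [_ [_ [e' [_ ee]]]]].
  by apply/suffixP; exists [::].
by apply/suffixP; exists (x ++ e'); rewrite -!catA ee.
Qed.

(** If w e1 = x1 w and w e1 e2 = x w, then x1 w e2 = x w, and cancelling x1 exhibits w as a suffix
    of w e2. *)
Lemma inCo_suffix e1 e2 : inCo w e1 -> 0 < size e2 -> inCo w (e1 ++ e2) -> inCo w e2.
Proof.
move=> [e10 [e1l [x1 [x10 ex1]]]] e20 [_ [el [x [x0 ex]]]].
rewrite size_cat in el.
have sx1 := congr1 size ex1; have sx := congr1 size ex; rewrite !size_cat in sx1 sx.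
split=> //; split; first by slia.
exists (drop (size x1) x); split; first by rewrite size_drop; slia.
have := congr1 (drop (size x1)) ex; rewrite catA ex1 -catA.
rewrite drop_size_cat // drop_cat.
by have -> : size x1 < size x by slia.
Qed.

(** The words of K generate C*: a last factor outside K splits into two factors in [inCo], the
    second of them shorter, so the induction is on the length of the last factor. Factors in K,
    unlike those in C, make the decomposition unique. *)
Lemma inwCstar_split T : inwCstar w T ->
  T = w \/ exists s v, [/\ T = s ++ v, inwCstar w s & inK w v].
Proof.
elim/inwCstar_ind => [|s e Cs _ Ce]; [by left | right].
have [m] := ubnP (size e); elim: m s e Cs Ce => // m IHm s e Cs Ce em.
have [K|nK] := pselect (inK w e); first by exists s, e.
have [e1 [e2 [C1 [e20 ee]]]] : exists e1 e2, inCo w e1 /\ 0 < size e2 /\ e = e1 ++ e2.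
  by apply: contrapT => nex; apply: nK.
have C2 : inCo w e2 by apply: inCo_suffix C1 e20 _; rewrite -ee.
rewrite ee catA; apply: IHm => //; first by apply: inwCstar_cat => //; right.
by move: em (C1.1); rewrite ee size_cat; slia.
Qed.

End Decompositions.

(** * Generating series of weighted languages *)

Section WordSeries.
Variables (R : comNzRingType) (A : finType) (p : A -> R).
Implicit Types (W : seq A -> ps3 R) (L : seq A -> Prop) (a b c : seq A -> nat).

(** The monomial records x, t and u only; [gf] supplies z by sorting the words by length. *)
Definition wlang L a b c : seq A -> ps3 R := fun v =>
  if pb (L v) then mon (Pw p v) (a v) (b v) (c v) else 0.

Definition wconv W1 W2 : seq A -> ps3 R := fun T =>
  \sum_(k < (size T).+1) W1 (take k T) * W2 (drop k T).

Definition gf W : ps4 R := fun n => \sum_(T : n.-tuple A) W T.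

Lemma Pw_cat s v : Pw p (s ++ v) = Pw p s * Pw p v.
Proof. exact: big_cat. Qed.

Lemma wlang_in L a b c v : L v -> wlang L a b c v = mon (Pw p v) (a v) (b v) (c v).
Proof. by rewrite /wlang; case: pbP. Qed.

Lemma wlang_notin L a b c v : ~ L v -> wlang L a b c v = 0.
Proof. by rewrite /wlang; case: pbP. Qed.

(** Unambiguity leaves at most one nonzero term among all cuts of [T], and additivity of the
    statistics makes that term the monomial of [T]. All three functional equations, for G, E and the
    clump series, are instances. *)
Lemma wlang_unambiguous_split L L0 L1 L2 a a0 a1 a2 b b0 b1 b2 c c0 c1 c2 :
  (forall T, L T -> L0 T \/ exists s v, [/\ T = s ++ v, L1 s & L2 v]) ->
  (forall T, L0 T -> [/\ L T, a T = a0 T, b T = b0 T & c T = c0 T]) ->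
  (forall s v, L1 s -> L2 v -> ~ L0 (s ++ v) /\
    [/\ L (s ++ v), a (s ++ v) = a1 s + a2 v, b (s ++ v) = b1 s + b2 v
      & c (s ++ v) = c1 s + c2 v]%N) ->
  (forall s v s' v', L1 s -> L2 v -> L1 s' -> L2 v' -> s ++ v = s' ++ v' ->
     size s = size s') ->
  wlang L a b c =1
    fun T => wlang L0 a0 b0 c0 T + wconv (wlang L1 a1 b1 c1) (wlang L2 a2 b2 c2) T.
Proof.
move=> split_L L0_L cat_L uniq_L T.
have zero k : ~ (L1 (take k T) /\ L2 (drop k T)) ->
    wlang L1 a1 b1 c1 (take k T) * wlang L2 a2 b2 c2 (drop k T) = 0.
  have [L1k|nL1] := pselect (L1 (take k T)); last by rewrite wlang_notin // mul0r.
  have [L2k|nL2] := pselect (L2 (drop k T)); first by case; split.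
  by rewrite (@wlang_notin L2) // mulr0.
have [LT|nLT] := pselect (L T); last first.
  rewrite wlang_notin // wlang_notin ?add0r; last by move=> /L0_L[].
  rewrite /wconv big1 // => k _; apply: zero => -[L1k L2k].
  by have [_ []] := cat_L _ _ L1k L2k; rewrite cat_take_drop.
have [L0T|nL0T] := pselect (L0 T).
  have [_ ea eb ec] := L0_L T L0T.
  rewrite !wlang_in // ea eb ec /wconv big1 ?addr0 // => k _.
  apply: zero => -[L1k L2k].
  by have [+ _] := cat_L _ _ L1k L2k; rewrite cat_take_drop.
case: (split_L T LT) => // -[s [v [eT L1s L2v]]].
rewrite (@wlang_notin L0) // add0r wlang_in // /wconv.
have sT : (size s < (size T).+1)%N by rewrite eT size_cat ltnS leq_addr.
rewrite (bigD1 (Ordinal sT)) //= big1 ?addr0; last first.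
  move=> k /eqP nk; apply: zero => -[L1k L2k]; apply: nk; apply: val_inj => /=.
  rewrite (@uniq_L s v _ _ L1s L2v L1k L2k) ?cat_take_drop -?eT //.
  by rewrite size_takel // -ltnS.
rewrite eT take_size_cat // drop_size_cat // !wlang_in // monM -Pw_cat.
by have [_ [_ -> -> ->]] := cat_L _ _ L1s L2v.
Qed.

Lemma big_tuple_cons n (F : seq A -> ps3 R) :
  \sum_(T : n.+1.-tuple A) F T = \sum_x \sum_(T : n.-tuple A) F (x :: T).
Proof.
rewrite pair_big /= (reindex (fun xT : A * n.-tuple A => [tuple of xT.1 :: xT.2])) //.
exists (fun T => (thead T, [tuple of behead T])) => [[x T] _|T _] /=.
  by congr (_, _); apply: val_inj.
exact/esym/tuple_eta.
Qed.

(** Stating the length as an equation allows n = k + (n - k) without casting tuples. *)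
Lemma big_tuple_split n i m (F : seq A -> seq A -> ps3 R) : n = (i + m)%N ->
  \sum_(T : n.-tuple A) F (take i T) (drop i T) =
  \sum_(s : i.-tuple A) \sum_(v : m.-tuple A) F s v.
Proof.
move=> ->; elim: i F => [|i IHi] F.
  rewrite [RHS](big_pred1 [tuple]); last by move=> s; apply/esym/eqP; exact: tuple0.
  by apply: eq_bigr => T _; rewrite take0 drop0.
rewrite (@big_tuple_cons (i + m) (fun T => F (take i.+1 T) (drop i.+1 T))).
rewrite (@big_tuple_cons i (fun s => \sum_(v : m.-tuple A) F s v)).
by apply: eq_bigr => x _; rewrite -(IHi (fun s v => F (x :: s) v)).
Qed.

Lemma gf_conv W1 W2 : gf (wconv W1 W2) = gf W1 * gf W2.
Proof.
apply: funext => n; rewrite ps_mulE /gf /wconv.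
transitivity (\sum_(T : n.-tuple A) \sum_(k < n.+1) W1 (take k T) * W2 (drop k T)).
  by apply: eq_bigr => T _; rewrite size_tuple.
rewrite exchange_big; apply: eq_bigr => k _.
have kn : (k + (n - k) = n)%N by rewrite subnKC // -ltnS.
by rewrite big_distrlr -(big_tuple_split (fun s v => W1 s * W2 v) (esym kn)).
Qed.

Lemma gf_add W1 W2 : gf (fun v => W1 v + W2 v) = gf W1 + gf W2.
Proof. by apply: funext => n; rewrite ps_addE /gf big_split. Qed.

Lemma gf_sub W1 W2 : gf (fun v => W1 v - W2 v) = gf W1 - gf W2.
Proof. by apply: funext => n; rewrite /gf [LHS]sumrB. Qed.

Lemma gf_scale (r : ps3 R) W : gf (fun v => r * W v) = ps_mono 0 r * gf W.
Proof. by apply: funext => n; rewrite ps_mul_monoE subn0 /gf big_distrr. Qed.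

Lemma gf_wlangE L a b c n i j k : gf (wlang L a b c) n i j k =
  \sum_(v : n.-tuple A | [&& pb (L v), a v == i, b v == j & c v == k]) Pw p v.
Proof.
rewrite /gf !ps_sumE [RHS]big_mkcond; apply: eq_bigr => v _.
rewrite /wlang; case: (pb _) => //=; rewrite monE.
by rewrite (eq_sym i) (eq_sym j) (eq_sym k).
Qed.

Lemma fz_gfcE L : fz (gfc p L) = gf (wlang L (fun=> 0%N) (fun=> 0%N) (fun=> 0%N)).
Proof.
apply: funext => n; apply: funext => i; apply: funext => j; apply: funext => k.
rewrite gf_wlangE /fz /gfc.
case: i => [|i]; last by rewrite [RHS]big_pred0 // => v; rewrite !andbF.
case: j => [|j]; last by rewrite [RHS]big_pred0 // => v; rewrite !andbF.
case: k => [|k]; last by rewrite [RHS]big_pred0 // => v; rewrite !andbF.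
by apply: eq_bigl => v; rewrite /= andbT.
Qed.

Lemma fzt_gfcE L : fzt (gfc p L) = gf (wlang L (fun=> 0%N) size (fun=> 0%N)).
Proof.
apply: funext => n; apply: funext => i; apply: funext => j; apply: funext => k.
rewrite gf_wlangE /fzt /gfc.
case: i => [|i]; last by rewrite [RHS]big_pred0 // => v; rewrite !andbF.
case: k => [|k]; last by rewrite !andbF [RHS]big_pred0 // => v; rewrite !andbF.
rewrite andbT /=; case: eqP => [->|nj].
  by apply: eq_bigl => v; rewrite size_tuple eqxx andbT.
rewrite [RHS]big_pred0 // => v; rewrite size_tuple.
by case: eqP => [e|]; rewrite ?andbF //; case: nj.
Qed.

End WordSeries.

(** * The linear system *)

Section SeriesIdentities.
Variables (R : comNzRingType) (A : finType) (p : A -> R) (w : seq A).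
Hypothesis w_gt0 : (0 < size w)%N.
Local Notation l := (size w).
Local Notation c0 := (fun=> 0%N).
Local Notation c1 := (fun=> 1%N).

Definition end_series := gf (wlang p (suffix w) (occ w) (cov w) (cl w)).

Definition step_series :=
  gf (wlang p (inMl w) c1 (fun v => minn l (size v)) (fun v => l <= size v)%N).

Lemma Gser_split : Gser p w = (Nser p w : ps4 R) + end_series * (User p w : ps4 R).
Proof.
have -> : Gser p w = gf (wlang p (fun=> True) (occ w) (cov w) (cl w)).
  apply: funext => n; apply: funext => i; apply: funext => j; apply: funext => k.
  rewrite gf_wlangE; apply: eq_bigl => T.
  by case: pbP.
rewrite /Nser /User !fz_gfcE -gf_conv -gf_add; congr gf; apply: funext.
apply: wlang_unambiguous_split => [T _|T N|s v ws U|s v s' v'].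
- exact: text_split.
- by have [] := stat_inNl w_gt0 N.
- split; first exact: suffix_cat_notin_inNl.
  by have [-> -> ->] := stat_inUl w_gt0 ws U; rewrite !addn0.
exact: text_split_uniq.
Qed.

Lemma end_series_split : end_series =
  (fmon 1 0 1 l 1 : ps4 R) * (Rser p w : ps4 R) + end_series * step_series.
Proof.
rewrite /Rser fz_gfcE fmonE -gf_scale -gf_conv -gf_add; congr gf; apply: funext => T.
rewrite (@wlang_unambiguous_split _ _ _ _ (inRl w) (suffix w) (inMl w)
  _ c1 (occ w) c1 _ (fun=> l) (cov w) (fun v => minn l (size v))
  _ c1 (cl w) (fun v => (l <= size v)%N)).
- congr (_ + _); rewrite /wlang; case: pb; last by rewrite mulr0.
  by rewrite monM mul1r !addn0.
- by move=> T'; apply: suffix_split.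
- move=> T' RT; have [-> -> ->] := stat_inRl w_gt0 RT.
  by split=> //; have [] := (inRl_occ w_gt0 T').1 RT.
- move=> s v ws M; split; first by apply: suffix_cat_notin_inRl => //; case: M.
  have [-> -> ->] := stat_inMl w_gt0 ws M; split=> //.
  exact: suffix_cat_inMl.
exact: suffix_split_uniq.
Qed.

(* A step shorter than [w] prolongs the current clump; the other ones open a new clump. *)
Lemma step_seriesE : step_series =
  (fmon 1 0 1 0 0 : ps4 R) * (fzt (gfc p (inK w)) : ps4 R) +
  (fmon 1 0 1 l 1 : ps4 R) * ((Mser p w : ps4 R) - (Kser p w : ps4 R)).
Proof.
rewrite /Mser /Kser !fz_gfcE fzt_gfcE !fmonE -gf_sub -!gf_scale -gf_add.
congr gf; apply: funext => v; rewrite /wlang.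
case: pbP => [Mv|nM]; last first.
  by case: pbP => [/(inK_inMl w_gt0)[]//|_]; rewrite subr0 !mulr0 addr0.
case: pbP => [/(inK_inMl w_gt0)[_ lv]|nK].
  rewrite subrr mulr0 addr0 monM mul1r (minn_idPr (ltnW lv)) leqNgt lv.
  by rewrite addn0.
have lv : (l <= size v)%N.
  by rewrite leqNgt; apply/negP => lv; apply/nK/(inK_inMl w_gt0).
by rewrite subr0 mulr0 add0r monM mul1r lv (minn_idPl lv) !addn0.
Qed.

Lemma gf_word a b c :
  gf (wlang p (eq^~ w) (fun=> a) (fun=> b) (fun=> c)) = fmon (pi_w p w) l a b c.
Proof.
rewrite fmonE; apply: funext => n; rewrite /gf /ps_mono.
case: eqP => [->|nl]; last first.
  rewrite big1 // => v _; apply: wlang_notin => e; apply: nl.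
  by rewrite -e size_tuple.
rewrite (bigD1 (in_tuple w)) //= wlang_in // big1 ?addr0 // => v /eqP nv.
by apply: wlang_notin => e; apply: nv; apply: val_inj.
Qed.

Lemma gfc_low L n : (forall v, L v -> (l <= size v)%N) -> (n < l)%N -> gfc p L n = 0.
Proof.
move=> Ll nl; rewrite /gfc big_pred0 // => v; apply/negP => /pbP/Ll.
by rewrite size_tuple leqNgt nl.
Qed.

Lemma Rser_low n : (n < l)%N -> (Rser p w : ps4 R) n = 0.
Proof.
move=> nl; apply: funext => i; apply: funext => j; apply: funext => k.
rewrite -[RHS]/(0 : R) /Rser /fz gfc_low; [by case: ifP | | exact: nl].
by move=> v [[x ->] _]; rewrite size_cat leq_addl.
Qed.

(** Words of M shorter than w are exactly those of K, so M - K is divisible by z^l. *)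
Lemma MKser_low n : (n < l)%N -> ((Mser p w : ps4 R) - (Kser p w : ps4 R)) n = 0.
Proof.
move=> nl; apply: funext => i; apply: funext => j; apply: funext => k.
rewrite /Mser /Kser -[LHS]/(fz _ n i j k - fz _ n i j k) /fz /gfc.
case: ifP => _; last by rewrite subr0.
apply/eqP; rewrite subr_eq0; apply/eqP; apply: eq_bigl => v.
apply/pbP/pbP => [M|/(inK_inMl w_gt0)[]//]; apply/(inK_inMl w_gt0).
by rewrite size_tuple.
Qed.

End SeriesIdentities.

(** * The series of clump words *)

Section ClumpSeries.
Variables (R : fieldType) (A : finType) (p : A -> R) (w : seq A).
Hypothesis w_gt0 : (0 < size w)%N.
Local Notation l := (size w).
Local Notation c0 := (fun=> 0%N).
Local Notation c1 := (fun=> 1%N).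

Lemma clumpSer_gf :
  clumpSer p w = gf (wlang p (inwCstar w) (occ w) size c0).
Proof.
apply: funext => n; apply: funext => i; apply: funext => j; apply: funext => k.
rewrite gf_wlangE /clumpSer.
case: (eqVneq j n) => [->|/negbTE nj] /=; last first.
  by rewrite [RHS]big_pred0 // => v; rewrite size_tuple (eq_sym n) nj !andbF.
case: k => [|k] /=; last by rewrite [RHS]big_pred0 // => v; rewrite !andbF.
by apply: eq_bigl => v; rewrite size_tuple eqxx andbT.
Qed.

(** A clump word is w itself or a shorter clump word followed by a word [v] of K, which brings one
    occurrence and |v| letters. Since K lies in M, uniqueness of the cut is inherited from
    M-steps. *)
Lemma clumpSer_split : (clumpSer p w : ps4 R) = (fmon (pi_w p w) l 1 l 0 : ps4 R) +
  (clumpSer p w : ps4 R) *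
  ((fmon 1 0 1 0 0 : ps4 R) * (fzt (gfc p (inK w)) : ps4 R)).
Proof.
rewrite clumpSer_gf -gf_word fzt_gfcE fmonE -gf_scale -gf_conv -gf_add.
congr gf; apply: funext => T.
rewrite (@wlang_unambiguous_split _ _ _ _ (eq^~ w) (inwCstar w) (inK w)
  _ c1 (occ w) c1 _ (fun=> l) size size _ c0 c0 c0).
- congr (_ + _); apply: eq_bigr => k _; congr (_ * _); rewrite /wlang.
  by case: pb; rewrite ?mulr0 // monM mul1r.
- by move=> T'; apply: inwCstar_split.
- move=> T' ->; split=> //; first exact: inwCstar_nil.
  have Rw : inRl w w.
    split; first by exists [::].
    by move=> [x [y [/(congr1 size) + y0]]]; rewrite !size_cat; lia.
  by have [] := stat_inRl w_gt0 Rw.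
- move=> s v Cs /[dup] Kv /(inK_inMl w_gt0)[Mv _].
  have ws := inwCstar_suffix Cs.
  split.
    move=> e; have := size_suffix ws; have [v0 _] := Mv.
    by rewrite -e size_cat -[X in (_ <= X)%N]addn0 leq_add2l leqNgt v0.
  have [-> _ _] := stat_inMl w_gt0 ws Mv; rewrite size_cat; split=> //.
  by apply: inwCstar_cat => //; right; case: Kv.
move=> s v s' v' /inwCstar_suffix ws /(inK_inMl w_gt0)[Mv _].
move=> /inwCstar_suffix ws' /(inK_inMl w_gt0)[Mv' _].
exact: suffix_split_uniq ws Mv ws' Mv'.
Qed.

End ClumpSeries.

(** * Exact division by z^l and solution of the linear equations *)

Lemma fmul_const (R : comNzRingType) (f g : fps R) :
  fmul f g 0%N 0%N 0%N 0%N = f 0%N 0%N 0%N 0%N * g 0%N 0%N 0%N 0%N.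
Proof. by rewrite /fmul !big_ord1. Qed.

(** [fdivz] shifts coefficients and forgets the first [l] of them, so multiplying back recovers [f]
    because these are zero. *)
Lemma fdivzK (R : fieldType) (r : R) l (f : ps4 R) : r != 0 ->
  (forall n, (n < l)%N -> f n = 0) ->
  (fmon r l 0 0 0 : ps4 R) * (fscale r^-1 (fdivz l f) : ps4 R) = f.
Proof.
move=> r0 f0; apply: funext => n; rewrite fmonE ps_mul_monoE.
case: leqP => ln; last by rewrite f0.
apply: funext => i; apply: funext => j; apply: funext => k.
rewrite /mon !ps_mul_monoE /= !subn0 !ps_mul_monoE /= !subn0.
by rewrite ps_mul_monoE subn0 /fscale /fdivz subnK // mulrA mulfV // mul1r.
Qed.

Lemma geometric_solution (P : pzRingType) (x a h g : P) :
  x = a + x * h -> (1 - h) * g = 1 -> x = a * g.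
Proof.
move=> ex eg; have <- : x * (1 - h) = a by rewrite mulrBr mulr1 {1}ex addrK.
by rewrite -mulrA eg mulr1.
Qed.

(** Here [h] stands for the steps inside a clump and [q] for the opening of one. Multiplying E (1 -
    h - q M') = R' q by [g], the inverse of 1 - h, gives E (1 - M' q g) = R' q g, where q g is the
    series of whole clumps. *)
Lemma renewal_solution (P : comPzRingType) (E h q g M' R' g2 : P) :
  E = R' * q + E * (h + q * M') -> (1 - h) * g = 1 ->
  (1 - M' * (q * g)) * g2 = 1 -> E = R' * (q * g) * g2.
Proof.
move=> eE eg eg2.
have eE1 : E * (1 - h - q * M') = R' * q.
  by rewrite -[RHS](addrK (E * (h + q * M'))) -eE; ring.
have {1}-> : E = E * ((1 - M' * (q * g)) * g2) by rewrite eg2 mulr1.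
rewrite [LHS]mulrA; congr (_ * g2).
have -> : 1 - M' * (q * g) = (1 - h) * g - M' * (q * g) by rewrite eg.
by rewrite (mulrA R') -eE1; ring.
Qed.

Theorem mainTheorem4 (R : realFieldType) (A : finType) (p : A -> R) (w : seq A)
  (hA : (1 < #|A|)%N) (hp : forall a, 0 < p a) (hsum : \sum_(a : A) p a = 1)
  (hw : (2 <= size w)%N) :
  Gser p w = Fsub p w (fmul (fmon 1 0 0 0 1) (frakK p w))
  /\ frakK p w = clumpSer p w.
Proof.
have w_gt0 : (0 < size w)%N by exact: ltnW.
have pi0 : pi_w p w != 0.
  by rewrite /pi_w /Pw prodf_seq_neq0; apply/allP => a _; rewrite lt0r_neq0.
set h : ps4 R := (fmon 1 0 1 0 0 : ps4 R) * (fzt (gfc p (inK w)) : ps4 R).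
have eh : fmul (fmon 1 0 1 0 0) (fzt (gfc p (inK w))) = h by rewrite fmulE.
have gP : (1 - h) * (fgeom h : ps4 R) = 1.
  by apply: fgeomP; rewrite -eh fmul_const mul0r.
have eK : frakK p w = (fmon (pi_w p w) (size w) 1 (size w) 0 : ps4 R) * (fgeom h : ps4 R).
  by rewrite /frakK fmulE eh.
split; last first.
  by rewrite eK; exact/esym/(geometric_solution (clumpSer_split p w_gt0) gP).
pose Y : ps4 R := (fmon 1 0 0 0 1 : ps4 R) * (frakK p w : ps4 R).
pose M' : ps4 R := fscale (pi_w p w)^-1 (fdivz (size w) (fsub (Mser p w) (Kser p w))).
pose R' : ps4 R := fscale (pi_w p w)^-1 (fdivz (size w) (Rser p w)).
have -> : Fsub p w (fmul (fmon 1 0 0 0 1) (frakK p w)) =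
    (Nser p w : ps4 R) + R' * Y * (fgeom (M' * Y : ps4 R) : ps4 R) * (User p w : ps4 R).
  by rewrite /Fsub !fmulE.
rewrite (Gser_split p w_gt0).
(* N and U occur alike on both sides; what remains is the closed form of E. *)
rewrite [X in X * _](_ : _ = R' * Y * (fgeom (M' * Y : ps4 R) : ps4 R)) //.
(* The weight of a clump's first occurrence: u x t^l times the factor [pi_w] z^l that clears the
   denominators of M' and R'. *)
set q : ps4 R := (fmon 1 0 1 (size w) 1 : ps4 R) * (fmon (pi_w p w) (size w) 0 0 0 : ps4 R).
have eY : Y = q * (fgeom h : ps4 R).
  rewrite /Y eK mulrA; congr (_ * _).
  by rewrite /q !fmonM !mul1r !addn0 !add0n.
have MK : (fmon (pi_w p w) (size w) 0 0 0 : ps4 R) * M' = (Mser p w : ps4 R) - (Kser p w : ps4 R).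
  by apply: fdivzK => // n; apply: MKser_low.
have RK : (fmon (pi_w p w) (size w) 0 0 0 : ps4 R) * R' = Rser p w.
  by apply: fdivzK => // n; apply: Rser_low.
rewrite eY; apply: (@renewal_solution _ _ h q _ M' R').
- rewrite {1}(end_series_split p w_gt0) (step_seriesE p w_gt0) -/h -MK -RK.
  by congr (_ + _ * (_ + _)); rewrite /q; ring.
- exact: gP.
(* The constant term vanishes because Y carries the factor u. *)
rewrite -eY; apply: fgeomP.
by rewrite -fmulE fmul_const /Y -fmulE (@fmul_const _ (fmon _ _ _ _ _)) /fmon /= mul0r mulr0.
Qed.
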